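(* There exists an absolute positive constant $\kappa''$ such that the following holds. Let $d\ge2$, let $\mathcal{A}$ be the class of half-spaces in $\mathbb{R}^d$, and let $S=\{\mathbb{1}_A: A\in\mathcal{A}\}$. Then, for $h\in[0,1]$, $$\inf_{\tilde s}\sup_{P\in\mathcal{P}(h,S)}\mathbb{E}[\ell(s^*,\tilde s)]\ge\kappa''(1-h)\,\frac{d}{nh}\left(1+\log\left(\frac{nh^2}{d}\right)\right)\qquad\text{if }h\ge\sqrt{d/n},$$ where the infimum is taken over all estimators $\tilde s$ based on the $n$-sample $(X_1,Y_1),\dots,(X_n,Y_n)$ and taking their values in $S$.
   Context: Binary classification setting with $\mathcal{X}=\mathbb{R}^d$: one observes $n$ independent copies $(X_1,Y_1),\dots,(X_n,Y_n)$ of a pair $(X,Y)$ with distribution $P$ on $\mathcal{X}\times\{0,1\}$. A classifier is a measurable map $t:\mathcal{X}\to\{0,1\}$; $\eta(x)=P[Y=1\mid X=x]$ is the regression function, $s^*(x)=\mathbb{1}_{\eta(x)\ge1/2}$ is the Bayes classifier (both depend on $P$), and $\ell(s^*,t)=P(Y\ne t(X))-P(Y\ne s^*(X))$. $\mathcal{P}(h,S)$ is the set of probability distributions $P$ on $\mathcal{X}\times\{0,1\}$ such that $|2\eta(x)-1|\ge h$ for all $x\in\mathcal{X}$ and $s^*\in S$. The expectation is under the sample having distribution $P^{\otimes n}$. *)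

(* Defs.v *)
From HB Require Import structures.
From mathcomp Require Import all_boot all_order all_algebra.
From mathcomp Require Import all_classical all_reals all_analysis.

Set Implicit Arguments.
Unset Strict Implicit.
Unset Printing Implicit Defensive.

Import Order.TTheory GRing.Theory Num.Theory.
Import numFieldNormedType.Exports.

Local Open Scope classical_set_scope.
Local Open Scope ring_scope.

Section iid_sample.
Context {dT} {T : measurableType dT} {R : realType}.

Definition tuple_cons n (z : T * n.-tuple T) : n.+1.-tuple T :=
  [tuple of z.1 :: z.2].

Lemma measurable_tuple_cons n : measurable_fun setT (@tuple_cons n).
Proof. exact: measurable_cons. Qed.

HB.instance Definition _ n :=
  isMeasurableFun.Build _ _ _ _ (@tuple_cons n) (@measurable_tuple_cons n).

(* The product measure P^{\otimes n} on samples of size n; it is characterised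
   by its values on rectangles, see [iid_rectangle]. *)
Fixpoint iid (P : probability T R) (n : nat) : probability (n.-tuple T) R :=
  match n with
  | 0 => \d_([tuple] : 0.-tuple T)
  | m.+1 => distribution (P \x iid P m)%E (@tuple_cons m)
  end.

Lemma iid_rectangle (P : probability T R) n (A : 'I_n -> set T) :
  (forall i, measurable (A i)) ->
  iid P n [set z | forall i, A i (tnth z i)] = (\prod_(i < n) P (A i))%E.
Proof.
elim: n A => [|n IHn] A mA.
  by rewrite big_ord0 /= diracE mem_set// => -[].
rewrite big_ord_recl /= /distribution /pushforward.
rewrite -IHn//.
pose B := [set z : n.-tuple T | forall i, A (lift ord0 i) (tnth z i)].
have mB : measurable B.
  have -> : B = \bigcap_(i in [set: 'I_n])
      ((fun z : n.-tuple T => tnth z i) @^-1` A (lift ord0 i)).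
    by apply/seteqP; split => [z Bz i _|z Bz i]; [exact: Bz|exact: (Bz i)].
  apply: fin_bigcap_measurable => // i _; rewrite -[X in measurable X]setTI.
  by apply: measurable_tnth => //; exact: mA.
have -> : @tuple_cons n @^-1` [set z | forall i, A i (tnth z i)] =
    A ord0 `*` B.
  apply/seteqP; split => [[x z]|[x z] [/= A0 AB]] /=.
    move=> H; split => /=; first exact: (H ord0).
    by move=> i; have := H (lift ord0 i); rewrite tnthS.
  move=> i; case: (unliftP ord0 i) => [j ->|->//].
  by rewrite tnthS; exact: AB.
by rewrite product_measure1E.
Qed.

End iid_sample.

Section classification.
Context {dX} {X : measurableType dX} {R : realType}.
Implicit Types (P : probability (X * bool)%type R) (s t : X -> bool)
  (S : set (X -> bool)) (eta : X -> R) (h : R).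

(* [eta] is a version of the conditional probability x |-> P[Y = 1 | X = x];
   it is determined by P only up to a P_X-null set. *)
Definition is_regression P eta :=
  [/\ measurable_fun setT eta,
      forall x, 0 <= eta x <= 1 &
      forall A : set X, measurable A ->
        P [set z | A z.1 /\ z.2 = true] =
        (\int[P]_(z in [set z | A z.1]) (eta z.1)%:E)%E].

Definition bayes eta : X -> bool := fun x => 2^-1 <= eta x.

Definition is_bayes P s := exists2 eta, is_regression P eta & s = bayes eta.

Definition classification_risk P t : R := fine (P [set z | z.2 != t z.1]).

(* The loss l(s, t), used with s a Bayes classifier of P. *)
Definition excess_risk P s t : R :=
  classification_risk P t - classification_risk P s.

(* The class P(h, S). The margin and membership conditions involve the values
   of the regression function at every point, hence they are required of one of
   its versions, the same for both. *)
Definition margin_class h S : set (probability (X * bool)%type R) :=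
  [set P | exists eta, [/\ is_regression P eta,
    forall x, h <= `|2 * eta x - 1| & S (bayes eta)]].

(* Joint measurability in the sample and the point makes the loss of [e] a
   random variable. *)
Definition is_estimator n S (e : n.-tuple (X * bool) -> X -> bool) :=
  (forall z, S (e z)) /\
  measurable_fun [set: n.-tuple (X * bool) * X] (fun p => e p.1 p.2).

(* All Bayes classifiers of P have the same risk, so letting s range over all
   of them does not change the supremum over P. *)
Definition maximal_risk n h S (e : n.-tuple (X * bool) -> X -> bool) : \bar R :=
  ereal_sup [set r | exists P s, [/\ margin_class h S P, is_bayes P s &
    r = ('E_(iid P n)[fun z => excess_risk P s (e z)])%E]].

Definition minimax_risk n h S : \bar R :=
  ereal_inf [set maximal_risk h S e | e in @is_estimator n S].

End classification.

Section halfspaces.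
Context {R : realType}.

(* R^d is [d.-tuple R], whose product sigma-algebra is the Borel one.
   Half-spaces are affine and closed. *)
Definition halfspaces d : set (set (d.-tuple R)) :=
  [set A | exists (a : d.-tuple R) (b : R), (exists i, tnth a i != 0) /\
    A = [set x | b <= \sum_(i < d) tnth a i * tnth x i]].

Definition halfspace_classifiers d : set (d.-tuple R -> bool) :=
  [set (fun x => x \in A) | A in @halfspaces d].

End halfspaces.

(* Main.v *)
(* The [D * m] points indexed by pairs [(j, k)], with [D = d / 2], are placed on the moment
   curve. In each of the [D] blocks exactly one point, the needle, has Bayes label 1; since
   every set of at most [d / 2] points of the curve is cut out by a half-space, all [m ^ D]
   such labellings are allowed. With uniform [X] and [eta = (1 +- h) / 2], a missed needle
   costs at least [h / (D m)]. Comparing with the law that has no needle in block [j]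
   shows that, averaged over the position of the needle, it is found with probability at
   most 1/2 as long as [16 (1 + 4 h ^ 2 / (D m (1 - h ^ 2))) ^ n <= m]; this holds for
   [m] of order [n h ^ 2 / (d (1 - h) (1 + ln (n h ^ 2 / d)))], and the resulting bound
   is [h / (2 m)]. *)
From HB Require Import structures.
Require Import Defs.
From mathcomp Require Import all_boot all_order all_algebra.
From mathcomp Require Import all_classical all_reals all_analysis.
From mathcomp Require Import measurable_realfun zify ring lra.

Set Implicit Arguments.
Unset Strict Implicit.
Unset Printing Implicit Defensive.

Import Order.TTheory GRing.Theory Num.Theory.
Import numFieldNormedType.Exports.

Local Open Scope classical_set_scope.
Local Open Scope ring_scope.

(** * Product weights on finite sample spaces *)

Lemma sum_tuple_cons (R : nmodType) (U : finType) n (F : n.+1.-tuple U -> R) :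
  \sum_(w : n.+1.-tuple U) F w =
  \sum_(u : U) \sum_(w : n.-tuple U) F [tuple of u :: w].
Proof.
rewrite pair_bigA/= (reindex (fun p : U * n.-tuple U => [tuple of p.1 :: p.2]))//=.
exists (fun w : n.+1.-tuple U => (thead w, [tuple of behead w])) => [[u w] _|w _] /=.
  by rewrite theadE; congr pair; apply: val_inj.
by rewrite [RHS]tuple_eta; apply: val_inj.
Qed.

Definition prod_weight (R : pzSemiRingType) (U : Type) (f : U -> R) n
    (w : n.-tuple U) : R :=
  \prod_(l < n) f (tnth w l).

Lemma prod_weight_cons (R : pzSemiRingType) (U : Type) (f : U -> R) n u (w : n.-tuple U) :
  prod_weight f [tuple of u :: w] = f u * prod_weight f w.
Proof.
rewrite /prod_weight big_ord_recl; congr (_ * _).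
by apply: eq_bigr => i _; rewrite tnthS.
Qed.

Lemma sum_prod_weight (R : pzSemiRingType) (U : finType) (f : U -> R) n :
  \sum_(w : n.-tuple U) prod_weight f w = (\sum_u f u) ^+ n.
Proof.
elim: n => [|n IHn].
  rewrite (eq_bigr (fun=> 1)) => [|w _]; last by rewrite /prod_weight big_ord0.
  by rewrite sumr_const card_tuple expn0.
rewrite sum_tuple_cons exprS -IHn big_distrl/=; apply: eq_bigr => u _.
by rewrite big_distrr/=; apply: eq_bigr => w _; rewrite prod_weight_cons.
Qed.

(* A hypothesis-testing bound for the alternatives [p k] against the reference law [q],
   obtained from the pointwise inequality [p <= lam q + p ^ 2 / (lam q)]. *)
Lemma sum_hits_le (R : realFieldType) (K Omega : finType) (q : Omega -> R)
    (p : K -> Omega -> R) (hit : K -> pred Omega) (lam X : R) :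
    0 < lam -> (forall w, 0 < q w) -> \sum_w q w = 1 ->
    (forall k, \sum_w p k w ^+ 2 / q w <= X) ->
    (forall w, \sum_k (hit k w)%:R <= 1 :> R) ->
  \sum_k \sum_w p k w * (hit k w)%:R <= lam + #|K|%:R * X / lam.
Proof.
move=> lam0 q0 q1 pX hit1.
have key k w : p k w * (hit k w)%:R <=
    lam * (q w * (hit k w)%:R) + p k w ^+ 2 / q w / lam.
  have x0 : 0 < lam * q w by rewrite mulr_gt0.
  have -> : p k w ^+ 2 / q w / lam = p k w ^+ 2 / (lam * q w).
    by field; rewrite !lt0r_neq0.
  case: (hit k w); rewrite ?mulr1 ?mulr0 ?add0r.
    rewrite -(ler_pM2r x0) mulrDl divfK ?lt0r_neq0//.
    by nra.
  by rewrite divr_ge0 ?sqr_ge0 ?ltW.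
apply: (@le_trans _ _ (\sum_k (lam * (\sum_w q w * (hit k w)%:R) + X / lam))).
  apply: ler_sum => k _.
  apply: (le_trans (ler_sum _ (fun w _ => key k w))).
  by rewrite big_split/= -mulr_sumr lerD2l -mulr_suml ler_wpM2r ?invr_ge0 ?(ltW lam0).
rewrite big_split/= -mulr_sumr exchange_big/= sumr_const -[X / lam *+ _]mulr_natl.
rewrite mulrA lerD2r -[leRHS]mulr1 ler_pM2l//.
rewrite -[leRHS]q1.
by apply: ler_sum => w _; rewrite -mulr_sumr -[leRHS]mulr1 ler_pM2l.
Qed.

(* Sampling a point uniformly and flipping its label [c i] with probability [(1 - h) / 2]. *)
Definition noisy_weight (R : realFieldType) (I : finType) (h : R) (c : I -> bool)
    (u : I * bool) : R :=
  #|I|%:R^-1 * (if u.2 == c u.1 then (1 + h) / 2 else (1 - h) / 2).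

(** * The uniform noisy law on finitely many points and its chi-square divergence *)

Section noisy.
Context {R : realFieldType} {I : finType}.
Implicit Types (h : R) (c q : I -> bool).

Lemma noisy_weight_ge0 h c u : 0 <= h <= 1 -> 0 <= noisy_weight h c u.
Proof.
move=> /andP[h0 h1]; rewrite /noisy_weight mulr_ge0 ?invr_ge0 ?ler0n//.
by case: ifP => _; lra.
Qed.

Lemma sum_pair_bool (f : I * bool -> R) :
  \sum_u f u = \sum_i (f (i, true) + f (i, false)).
Proof.
rewrite (eq_bigr (fun u => f (u.1, u.2))) => [|[]//].
rewrite -(pair_bigA _ (fun i y => f (i, y)))/=; apply: eq_bigr => i _.
by rewrite big_bool.
Qed.

Lemma sum_noisy_weight h c : (0 < #|I|)%N -> \sum_u noisy_weight h c u = 1.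
Proof.
move=> I0; rewrite sum_pair_bool (eq_bigr (fun=> #|I|%:R^-1)) => [|i _].
  by rewrite sumr_const -[LHS]mulr_natl divff// pnatr_eq0 -lt0n.
by rewrite /noisy_weight/= -mulrDr; case: (c i) => /=; field; rewrite pnatr_eq0 -lt0n.
Qed.

(** The two laws differ only at [i0], where the likelihood ratios are [(1 + h) / (1 - h)] and its
    inverse. The two terms there add up to [(1 + 4 * h ^+ 2 / (1 - h ^+ 2)) / #|I|], and every other
    point contributes [1 / #|I|]. *)
Lemma chi_square_noisy_weight h c q i0 :
    0 <= h < 1 -> q =1 (fun i => c i && (i != i0)) -> c i0 ->
  \sum_u noisy_weight h c u ^+ 2 / noisy_weight h q u =
    1 + 4 * h ^+ 2 / (#|I|%:R * (1 - h ^+ 2)).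
Proof.
move=> /andP[h0 h1] qE ci0.
have hD : 1 + h != 0 by lra.
have hB : 1 - h != 0 by lra.
have hh : 1 - h ^+ 2 != 0 by rewrite (_ : _ - _ = (1 - h) * (1 + h)) ?mulf_neq0//; ring.
have cI : (0 < #|I|)%N by apply/card_gt0P; exists i0.
have cI0 : (#|I|%:R : R) != 0 by rewrite pnatr_eq0 -lt0n.
rewrite sum_pair_bool (bigD1 i0)//=.
rewrite [X in _ + X](eq_bigr (fun=> #|I|%:R^-1)) => [|i ii0]; last first.
  rewrite /noisy_weight/= qE ii0 andbT; case: (c i) => /=; field; rewrite ?cI0 ?hD ?hB//.
rewrite /noisy_weight/= qE ci0 !eqxx/= sumr_const cardC1.
rewrite -[#|I|%:R^-1 *+ _]mulr_natl -subn1 natrB//.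
by field; rewrite hh cI0 ?hD ?hB.
Qed.

End noisy.

(** * Expected number of errors on needle labellings *)

Section blocks.
Context {R : realFieldType} {D m : nat}.
Local Notation I := ('I_D * 'I_m)%type.
Implicit Types (b : {ffun 'I_D -> 'I_m}) (h : R).

Definition needle b (i : I) : bool := b i.1 == i.2.

Definition upd b j k : {ffun 'I_D -> 'I_m} := [ffun j' => if j' == j then k else b j'].

(** Redrawing the needle of block [j] uniformly keeps the labelling uniform, so block [j] can be
    studied with all other needles frozen. *)
Lemma sum_upd (F : {ffun 'I_D -> 'I_m} -> R) j :
  \sum_b \sum_k F (upd b j k) = m%:R * \sum_b F b.
Proof.
have -> : m%:R * (\sum_b F b) = \sum_b \sum_(k < m) F b.
  by rewrite mulr_sumr; apply: eq_bigr => b _; rewrite sumr_const card_ord mulr_natl.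
(* [(b, k) |-> (upd b j k, b j)] is an involution. *)
rewrite !pair_bigA/= [RHS](reindex_inj (h := fun p => (upd p.1 j p.2, p.1 j)))//.
apply: (can_inj (g := fun p => (upd p.1 j p.2, p.1 j))) => -[b k] /=.
congr pair; last by rewrite ffunE eqxx.
by apply/ffunP => j'; rewrite !ffunE; case: eqP => // ->.
Qed.

(* The reference law is the one without a needle in block [j]: the likelihood ratio of a
   law of the family to it differs from 1 only at the needle of that block. *)
Lemma block_hits_le n h (g : n.-tuple (I * bool) -> I -> bool) j :
    (0 < m)%N -> 0 <= h < 1 ->
    16 * (1 + 4 * h ^+ 2 / ((D * m)%:R * (1 - h ^+ 2))) ^+ n <= m%:R ->
  \sum_b \sum_w prod_weight (noisy_weight h (needle b)) w *
    [forall k, g w (j, k) == (b j == k)]%:R <= #|{ffun 'I_D -> 'I_m}|%:R / 2.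
Proof.
move=> m0 h01 Hm; have m0' : 0 < m%:R :> R by rewrite ltr0n.
rewrite -(ler_pM2l m0') -(sum_upd _ j) mulrCA mulr_natl -sumr_const.
apply: ler_sum => b _ /=.
pose q i := needle b i && (i.1 != j).
pose hit k w := [forall k', g w (j, k') == (k == k')].
pose X := (1 + 4 * h ^+ 2 / ((D * m)%:R * (1 - h ^+ 2))) ^+ n.
have DK : (0 < D)%N by apply: leq_trans (ltn_ord j).
have I0 : (0 < #|{: I}|)%N by rewrite card_prod !card_ord muln_gt0 DK.
(* With [lam = m / 4] the bound is [m / 4 + 4 * X], and the assumption [16 * X <= m] makes it at
   most [m / 2]. *)
have := @sum_hits_le R _ _ (@prod_weight _ _ (noisy_weight h q) n)
  (fun k => @prod_weight _ _ (noisy_weight h (needle (upd b j k))) n) hit (m%:R / 4) X.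
have updE k w : [forall k', g w (j, k') == (upd b j k j == k')] = hit k w.
  by rewrite /hit ffunE eqxx.
under eq_bigr => k _ do under eq_bigr => w _ do rewrite updE.
move=> H; apply: (le_trans (H _ _ _ _ _)) => {H}.
- by rewrite divr_gt0.
- move=> w; apply: prodr_gt0 => l _; rewrite /noisy_weight mulr_gt0 ?invr_gt0 ?ltr0n//.
  by case: ifP => _; lra.
- by rewrite sum_prod_weight sum_noisy_weight// expr1n.
(* The second moment of the likelihood ratio factorises over the sample, which gives the [n]-th
   power of the one-draw value. *)
- move=> k; rewrite (eq_bigr (@prod_weight _ _ (fun u =>
      noisy_weight h (needle (upd b j k)) u ^+ 2 / noisy_weight h q u) n)).
    rewrite sum_prod_weight (@chi_square_noisy_weight _ _ _ _ _ (j, k))//.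
    + by rewrite card_prod !card_ord.
    + move=> [j' k'] /=; rewrite /q /needle/= !ffunE xpair_eqE/=.
      case: (eqVneq j' j) => _ /=; rewrite ?andbF ?andbT//.
      by rewrite [k' == k]eq_sym andbN.
    + by rewrite /needle /= ffunE eqxx.
  by move=> w _; rewrite /prod_weight -prodrXl -prodf_div.
(* A hit at [k] forces [g w (j, _)] to be the indicator of [k], so two different positions cannot
   both be hit. *)
- move=> w; have [k hk|nh] := pickP (hit^~ w).
    rewrite (bigD1 k)//= hk big1 ?addr0// => k' k'k.
    case: (boolP (hit k' w)) => // /forallP/(_ k')/eqP.
    by rewrite eqxx; move/forallP: hk => /(_ k')/eqP ->; rewrite eq_sym (negbTE k'k).
  by rewrite big1 // => k _; rewrite nh.
rewrite card_ord (_ : _ / (m%:R / 4) = 4 * X); last by field; rewrite lt0r_neq0.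
by rewrite -/X in Hm; lra.
Qed.

(** A block that is not labelled exactly right contains at least one error. Averaged over [b], each
    block is right with probability at most 1/2, so the mean number of errors is at least [D / 2],
    and some [b] reaches this mean. *)
Lemma needle_lower_bound n h (g : n.-tuple (I * bool) -> I -> bool) :
    (0 < m)%N -> 0 <= h < 1 ->
    16 * (1 + 4 * h ^+ 2 / ((D * m)%:R * (1 - h ^+ 2))) ^+ n <= m%:R ->
  exists b, D%:R / 2 <= \sum_w prod_weight (noisy_weight h (needle b)) w *
     \sum_i (g w i != needle b i)%:R.
Proof.
move=> m0 h01 Hm.
have [Dz|D0] := posnP D.
  have -> : D%:R = 0 :> R by rewrite Dz.
  exists [ffun=> Ordinal m0]; rewrite mul0r sumr_ge0// => w _.
  rewrite mulr_ge0 ?sumr_ge0// prodr_ge0// => l _; rewrite noisy_weight_ge0//.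
  by case/andP: h01 => -> /ltW.
have I0 : (0 < #|{: I}|)%N by rewrite card_prod !card_ord muln_gt0 D0.
pose A b := \sum_w prod_weight (noisy_weight h (needle b)) w *
     \sum_i (g w i != needle b i)%:R.
apply/existsP; apply: contraT; rewrite negb_exists => /forallP Hlt.
pose H j b := \sum_w prod_weight (noisy_weight h (needle b)) w *
    [forall k, g w (j, k) == (b j == k)]%:R.
have Hb b : D%:R - \sum_j H j b <= A b.
  rewrite exchange_big/= lerBlDr -big_split/=.
  have -> : D%:R = \sum_(w : n.-tuple (I * bool))
      prod_weight (noisy_weight h (needle b)) w * D%:R :> R.
    by rewrite -mulr_suml sum_prod_weight sum_noisy_weight// expr1n mul1r.
  apply: ler_sum => w _; rewrite -mulr_sumr -mulrDr ler_wpM2l//.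
    rewrite prodr_ge0// => l _; rewrite noisy_weight_ge0//.
    by case/andP: h01 => -> /ltW.
  rewrite (eq_bigr (fun u => (g w (u.1, u.2) != needle b (u.1, u.2))%:R)) => [|[]//].
  rewrite -(pair_bigA _ (fun j k => (g w (j, k) != needle b (j, k))%:R))/= -big_split/=.
  rewrite -{1}(card_ord D) -sumr_const; apply: ler_sum => j _.
  case: (boolP [forall k, _]) => [_|].
    by rewrite lerDr sumr_ge0.
  rewrite negb_forall => /existsP[k hk].
  by rewrite (bigD1 k)//= /needle/= hk addr0 lerDl sumr_ge0.
suff: D%:R / 2 * #|{ffun 'I_D -> 'I_m}|%:R <= \sum_b A b.
  rewrite leNgt => /negP[].
  rewrite mulr_natr -sumr_const; apply: ltr_sum => [|b _].
    by apply/hasP; exists [ffun=> Ordinal m0]; rewrite ?mem_index_enum.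
  by have := Hlt b; rewrite -ltNge.
apply: le_trans (ler_sum _ (fun b _ => Hb b)).
rewrite big_split/= sumr_const -mulr_natr sumrN exchange_big/=.
have : \sum_j \sum_b H j b <= \sum_(j < D) (#|{ffun 'I_D -> 'I_m}|%:R / 2).
  by apply: ler_sum => j _; exact: block_hits_le.
by rewrite sumr_const card_ord -mulr_natr; nra.
Qed.

End blocks.

(** * From finite models to probability measures and estimators *)

Lemma exists_finite_probability d (T : measurableType d) (R : realType)
    (U : finType) (pt : U -> T) (w : U -> R) :
    (forall u, 0 <= w u) -> \sum_u w u = 1 ->
  exists P : probability T R,
    (forall A : set T, P A = (\sum_u w u * (pt u \in A)%:R)%:E) /\
    (forall (B : set T) (f : T -> R), measurable B -> measurable_fun B f ->
      (forall x, 0 <= f x) ->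
      (\int[P]_(x in B) (f x)%:E)%E =
      (\sum_u w u * ((pt u \in B)%:R * f (pt u)))%:E).
Proof.
move=> w0 w1.
(* [msum] adds up a sequence indexed by [nat], so the weighted Dirac masses are enumerated and
   padded with the zero measure. *)
pose m_ (k : nat) : {measure set T -> \bar R} :=
  if insub k is Some i
  then mscale (NngNum (w0 (@enum_val U predT i))) \d_(pt (enum_val i)) else mzero.
have mE (i : 'I_#|U|) :
    m_ i = mscale (NngNum (w0 (enum_val i))) \d_(pt (enum_val i)).
  by rewrite /m_ valK.
pose mu := msum m_ #|U|.
have muE (A : set T) : mu A = (\sum_u w u * (pt u \in A)%:R)%:E.
  rewrite /mu /msum (eq_bigr (fun i : 'I_#|U| =>
      (w (enum_val i) * (pt (enum_val i) \in A)%:R)%:E)) => [|i _].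
    by rewrite sumEFin [in RHS]big_enum_val.
  by rewrite mE EFinM -diracE.
have muT : mu setT = 1%E.
  by rewrite muE; congr EFin; rewrite -[RHS]w1; apply: eq_bigr => u _; rewrite mem_set// mulr1.
pose P : probability T R := HB.pack mu (Measure_isProbability.Build _ _ _ mu muT).
exists P; split=> // B f mB mf f0.
have /measurable_EFinP mf' := mf.
rewrite (@ge0_integral_measure_sum _ _ _ m_ B mB (EFin \o f))//; last first.
  by move=> x _; rewrite lee_fin.
rewrite (eq_bigr (fun i : 'I_#|U| => (w (enum_val i) *
    ((pt (enum_val i) \in B)%:R * f (pt (enum_val i))))%:E)) => [|i _].
  by rewrite sumEFin [in RHS]big_enum_val.
rewrite mE ge0_integral_mscale//; last by move=> x _; rewrite lee_fin.
by rewrite integral_dirac//= diracE.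
Qed.

(** Induction on [n] by Tonelli: the first draw is split off and the remaining ones are integrated
    by the induction hypothesis. *)
Lemma integral_iid_finite d (T : measurableType d) (R : realType) (P : probability T R)
    (U : finType) (pt : U -> T) (w : U -> R) n (F : n.-tuple T -> R) :
    (forall u, 0 <= w u) ->
    (forall f : T -> R, measurable_fun setT f -> (forall x, 0 <= f x) ->
      (\int[P]_x (f x)%:E)%E = (\sum_u w u * f (pt u))%:E) ->
    measurable_fun setT F -> (forall z, 0 <= F z) ->
  (\int[iid P n]_z (F z)%:E)%E =
  (\sum_(v : n.-tuple U) prod_weight w v * F (map_tuple pt v))%:E.
Proof.
move=> w0 intP; elim: n F => [|n IHn] F mF F0.
  rewrite /= (@integral_dirac _ _ _ _ setT _ (EFin \o F))//; last exact/measurable_EFinP.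
  rewrite diracT mul1e/= (big_pred1 [tuple]) => [|v]; last by rewrite (tuple0 v)/= eqxx.
  by rewrite /prod_weight big_ord0 mul1r; congr (F _)%:E; apply: val_inj.
have /measurable_EFinP mF' := mF.
rewrite /= (@ge0_integral_distribution _ _ _ _ _ _ _ (EFin \o F))//.
have mFc : measurable_fun setT (F \o @tuple_cons _ T n).
  by apply: measurableT_comp => //; exact: measurable_tuple_cons.
rewrite fubini_tonelli1/=; last 2 first.
- by apply: measurableT_comp => //; exact: measurable_tuple_cons.
- by move=> x; rewrite lee_fin.
have FE x : fubini_F (iid P n) ((EFin \o F) \o @tuple_cons _ T n) x =
   (\sum_(v : n.-tuple U) prod_weight w v * F (tuple_cons (x, map_tuple pt v)))%:E.
  rewrite /fubini_F/= (IHn (fun z => F (tuple_cons (x, z))))//.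
  exact: (measurable_fun_pair2 x mFc).
under eq_integral => x _ do rewrite FE.
rewrite intP; first last.
- by move=> x; apply: sumr_ge0 => v _; apply: mulr_ge0 => //; apply: prodr_ge0.
- apply: measurable_sum => v; apply: measurable_funM => //.
  exact: (measurable_fun_pair1 (map_tuple pt v) mFc).
rewrite sum_tuple_cons; congr EFin; apply: eq_bigr => u _.
rewrite mulr_sumr; apply: eq_bigr => v _; rewrite prod_weight_cons mulrA.
by congr (_ * F _); apply: val_inj.
Qed.

(** The law puts mass [noisy_weight h c (i, y)] on [(x i, y)]. Relative to [s], a wrong label at one
    of the points costs [h / #|I|], so the excess risk counts the errors. *)
Lemma exists_noisy_law dX (X : measurableType dX) (R : realType) (I : finType)
    (h : R) (x : I -> X) (c : I -> bool) (s : X -> bool) (S : set (X -> bool)) :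
    0 < h <= 1 -> (0 < #|I|)%N -> measurable_fun setT s ->
    (forall i, s (x i) = c i) -> S s ->
  exists P : probability (X * bool)%type R,
  [/\ margin_class h S P, is_bayes P s &
   forall n (e : n.-tuple (X * bool) -> X -> bool), is_estimator S e ->
   'E_(iid P n)[fun z => excess_risk P s (e z)]%E =
   (h / #|I|%:R * \sum_(v : n.-tuple (I * bool)) prod_weight (noisy_weight h c) v *
      \sum_i (e (map_tuple (fun u => (x u.1, u.2)) v) (x i) != c i)%:R)%:E].
Proof.
move=> /andP[h0 h1] I0 ms sx Ss.
have h01 : 0 <= h <= 1 by rewrite ltW.
have N0 : (#|I|%:R : R) != 0 by rewrite pnatr_eq0 -lt0n.
(* Extending [eta] through [s] to the whole space gives margin exactly [h] everywhere, also off the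
   atoms; [h > 0] makes [s] its Bayes classifier. *)
pose eta (z : X) : R := if s z then (1 + h) / 2 else (1 - h) / 2.
have bayes_eta : bayes eta = s.
  apply/funext => z; rewrite /bayes /eta.
  by case: (s z); [lra|apply/negbTE; rewrite -ltNge; lra].
have meta : measurable_fun setT eta.
  by apply: measurable_fun_ifT => //.
have eta01 z : 0 <= eta z <= 1 by rewrite /eta; case: ifP => _; lra.
have [P [PE intP]] := @exists_finite_probability _ _ _ _
  (fun u : I * bool => (x u.1, u.2)) (noisy_weight h c)
  (fun u => noisy_weight_ge0 c u h01) (sum_noisy_weight h c I0).
have reg : is_regression P eta.
  split=> // A mA; rewrite (intP _ (fun z => eta z.1)).
  - rewrite PE !sum_pair_bool; congr EFin; apply: eq_bigr => i _ /=.
    rewrite /noisy_weight/= /eta sx.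
    have -> : ((x i, true) \in [set z : X * bool | A z.1 /\ z.2 = true]) = (x i \in A).
      by apply/idP/idP; rewrite !inE//= => -[].
    have -> : ((x i, false) \in [set z : X * bool | A z.1 /\ z.2 = true]) = false.
      by apply/negP; rewrite inE/= => -[].
    have -> b : ((x i, b) \in [set z : X * bool | A z.1]) = (x i \in A).
      by apply/idP/idP; rewrite !inE.
    by case: (c i) => /=; field.
  - rewrite -[X in measurable X]setTI; exact: measurable_fst.
  - by apply/measurable_funTS; apply: measurableT_comp.
  - by move=> z; case/andP: (eta01 z.1).
have riskE t : classification_risk P t =
    #|I|%:R^-1 * \sum_i ((1 - h) / 2 + h * (t (x i) != c i)%:R).
  rewrite /classification_risk PE /= sum_pair_bool mulr_sumr; apply: eq_bigr => i _.
  rewrite /noisy_weight/=.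
  have E b : ((x i, b) \in [set z : X * bool | z.2 != t z.1]) = (b != t (x i)).
    by apply/idP/idP; rewrite !inE.
  by rewrite !E; case: (c i); case: (t (x i)) => /=; field.
have excessE t : excess_risk P s t = h / #|I|%:R * \sum_i (t (x i) != c i)%:R.
  rewrite /excess_risk !riskE -mulrBr -sumrB [h / _]mulrC -mulrA.
  congr (_ * _); rewrite mulr_sumr; apply: eq_bigr => i _.
  by rewrite sx eqxx mulr0 addr0 addrAC subrr add0r.
exists P; split.
- exists eta; split; rewrite ?bayes_eta// => z.
  by rewrite /eta; case: ifP => _; rewrite ler_normr; apply/orP; [left|right]; lra.
- by exists eta.
- move=> n e [_ me]; rewrite expectation.unlock.
  under eq_integral => z _ do rewrite excessE.
  rewrite (integral_iid_finite (pt := fun u : I * bool => (x u.1, u.2)) (w := noisy_weight h c)).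
  + by rewrite mulr_sumr; congr EFin; apply: eq_bigr => v _; rewrite mulrCA.
  + by move=> u; exact: noisy_weight_ge0.
  + move=> f mf f0; rewrite intP//; congr EFin; apply: eq_bigr => u _.
    by rewrite mem_set// mul1r.
  + apply: measurable_funM => //; apply: measurable_sum => i.
    pose flip (b : bool) : R := (b != c i)%:R.
    rewrite -[X in measurable_fun _ X]/(flip \o (fun z => e z (x i))).
    (* Every subset of [bool] is measurable, hence so is [flip]. *)
    apply: measurableT_comp; first by move=> _ Y _.
    exact: (measurable_fun_pair1 (x i) me).
  + move=> z; rewrite mulr_ge0 ?sumr_ge0// divr_ge0 ?ler0n//.
    exact: ltW.
Qed.

(** An estimator, fed with samples supported on the points [x i] and evaluated there, is a rule [g]
    of the finite model. The labelling that is bad for this [g] yields a law that is bad for the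
    estimator. *)
Lemma needle_minimax_risk dX (X : measurableType dX) (R : realType) (D m n : nat)
    (S : set (X -> bool)) (x : 'I_D * 'I_m -> X) (h r : R) :
    (0 < D)%N -> (0 < m)%N -> 0 < h <= 1 ->
    (forall b, exists s,
      [/\ S s, measurable_fun setT s & forall i, s (x i) = needle b i]) ->
    (forall g : n.-tuple ('I_D * 'I_m * bool) -> 'I_D * 'I_m -> bool, exists b,
      r <= \sum_w prod_weight (noisy_weight h (needle b)) w *
        \sum_i (g w i != needle b i)%:R) ->
  ((h / (D * m)%:R * r)%:E <= minimax_risk n h S)%E.
Proof.
move=> D0 m0 h01 shatter lower; apply/ereal_infP => _ [e est <-].
have [b rb] := lower (fun v i => e (map_tuple (fun u => (x u.1, u.2)) v) (x i)).
have [s [Ss ms sx]] := shatter b.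
have I0 : (0 < #|{: 'I_D * 'I_m}|)%N by rewrite card_prod !card_ord muln_gt0 D0.
have [P [PS Ps PE]] := exists_noisy_law h01 I0 ms sx Ss.
apply: le_trans (ereal_sup_ubound _); last by exists P, s; split.
rewrite PE// card_prod !card_ord lee_fin ler_wpM2l// divr_ge0 ?ler0n//.
by case/andP: h01 => /ltW.
Qed.

(** * Half-spaces and the moment curve *)

(** Exponents start at 1: the constant coefficient of a polynomial becomes the threshold of the
    half-space. *)
Definition moment_curve (R : pzSemiRingType) d (t : R) : d.-tuple R :=
  [tuple t ^+ k.+1 | k < d].

(* The half-space comes from the coefficients of [- \prod_(i in B) ('X - t i)^2],
   whose sign along the curve is nonnegative exactly at the points of [B]. *)
Lemma halfspace_moment_curve (R : realType) d (I : finType) (t : I -> R) (B : {pred I}) :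
    injective t -> (0 < #|B|)%N -> (2 * #|B| <= d)%N ->
  exists2 A, halfspaces A & forall i, (moment_curve d (t i) \in A) = (i \in B).
Proof.
move=> tI B0 Bd.
pose q : {poly R} := \prod_(i <- enum B) ('X - (t i)%:P).
have mq : q \is monic by exact: monic_prod_XsubC.
pose p := - (q * q).
have sp : size p = (2 * #|B|).+1.
  by rewrite size_polyN size_Mmonic ?monic_neq0// size_prod_XsubC -cardE; lia.
have lp : lead_coef p = -1.
  by rewrite lead_coefN lead_coefM (monicP mq) mulr1.
pose a : d.-tuple R := [tuple p`_k.+1 | k < d].
exists [set z | - p`_0 <= \sum_(k < d) tnth a k * tnth z k].
  exists a, (- p`_0); split=> //.
  (* The nonzero coordinate is the leading coefficient [-1]; the shift of exponents puts it at index
     [2 * #|B| - 1]. *)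
  have kd : ((2 * #|B|).-1 < d)%N by lia.
  exists (Ordinal kd); rewrite tnth_mktuple /= prednK ?muln_gt0//.
  by have := lp; rewrite lead_coefE sp/= => ->; rewrite oppr_eq0 oner_eq0.
move=> i.
have pE : p.[t i] = p`_0 + \sum_(k < d) tnth a k * tnth (moment_curve d (t i)) k.
  rewrite (@horner_coef_wide _ d.+1) ?sp// big_ord_recl/= expr0 mulr1; congr (_ + _).
  by apply: eq_bigr => k _; rewrite !tnth_mktuple.
have -> : (moment_curve d (t i) \in
    [set z | - p`_0 <= \sum_(k < d) tnth a k * tnth z k]) = (0 <= p.[t i]).
  by apply/idP/idP; rewrite inE/= pE -lerBlDl sub0r.
rewrite hornerN hornerM oppr_ge0 -expr2 le_eqVlt ltNge sqr_ge0 orbF sqrf_eq0.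
rewrite -[_ == 0]/(root q _) /q.
rewrite -(big_map t xpredT (fun y => 'X - y%:P)) root_prod_XsubC mem_map//.
by rewrite mem_enum.
Qed.

Lemma measurable_halfspace (R : realType) d (A : set (d.-tuple R)) :
  halfspaces A -> measurable A.
Proof.
move=> [a [b [_ ->]]].
pose f (x : d.-tuple R) := \sum_(i < d) tnth a i * tnth x i.
have mf : measurable_fun setT f.
  by apply: measurable_sum => i; apply: measurable_funM => //; exact: measurable_tnth.
rewrite (_ : [set x | _] = f @^-1` `[b, +oo[).
  by rewrite -[X in measurable X]setTI; apply: mf => //; exact: measurable_itv.
by apply/seteqP; split => z /=; rewrite in_itv/= andbT.
Qed.

Lemma measurable_halfspace_classifier (R : realType) d (A : set (d.-tuple R)) :
  halfspaces A -> measurable_fun setT (fun x => x \in A).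
Proof.
move=> /measurable_halfspace mA.
apply: (measurable_fun_bool true).
rewrite setTI [X in measurable X](_ : _ = A)//.
by apply/seteqP; split => z /=; [exact: set_mem|exact: mem_set].
Qed.

Lemma needle_halfspace (R : realType) d D m :
    (0 < D)%N -> (2 * D <= d)%N ->
  exists x : 'I_D * 'I_m -> d.-tuple R, forall b, exists s,
    [/\ halfspace_classifiers s, measurable_fun setT s & forall i, s (x i) = needle b i].
Proof.
move=> D0 Dd.
pose t (i : 'I_D * 'I_m) : R := (enum_rank i)%:R.
have tI : injective t by move=> i j /eqP; rewrite eqr_nat => /eqP /val_inj /enum_rank_inj.
exists (fun i => moment_curve d (t i)) => b.
have cB : #|needle b| = D.
  rewrite -[RHS](card_ord D) -(card_imset _ (f := fun j => (j, b j))); last by move=> j j' [].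
  apply: eq_card => -[j k]; rewrite unfold_in /needle/=; apply/eqP/imsetP => [<-|[j' _ [-> ->]]//].
  by exists j.
have [||A hA Ax] := halfspace_moment_curve (d := d) (B := needle b) tI; rewrite ?cB//.
exists (fun z => z \in A); split => //; first by exists A.
exact: measurable_halfspace_classifier.
Qed.

(** * Choice of the block length and the constant *)

(* The left-hand side is at most [16 exp ((1 + ln a) / 2) <= 32 sqrt a], while the
   assumed lower bound on [m] is at least [48 sqrt a]. *)
Lemma needle_size (R : realType) (d D m n : nat) (h : R) :
    let a := n%:R * h ^+ 2 / d%:R in
    0 < h < 1 -> (0 < D)%N -> (0 < d <= 3 * D)%N -> 1 <= a ->
    96 * a / ((1 - h) * (1 + ln a)) <= m%:R ->
  16 * (1 + 4 * h ^+ 2 / ((D * m)%:R * (1 - h ^+ 2))) ^+ n <= m%:R.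
Proof.
move=> a /andP[h0 h1] D0 /andP[d0 dD] a1 ym.
have a0 : 0 < a by lra.
have l0 : 0 <= ln a by rewrite ln_ge0.
set l := ln a in ym l0 *; set E := expR (l / 2).
have aE : a = E * E by rewrite /E -expRD -splitr /l lnK.
have lE : 1 + l / 2 <= E by exact: expR_ge1Dx.
have hl : 0 < (1 - h) * (1 + l) by rewrite mulr_gt0//; lra.
have E48 : 48 * E <= m%:R.
  apply: le_trans ym; rewrite ler_pdivlMr// aE.
  have : (1 - h) * (1 + l) <= 2 * E.
    apply: (@le_trans _ _ (1 + l)); last lra.
    by rewrite ler_piMl; lra.
  have : 0 <= E by lra.
  by nra.
have m0 : 0 < m%:R :> R by lra.
have D0' : 0 < D%:R :> R by rewrite ltr0n.
have d0' : 0 < d%:R :> R by rewrite ltr0n.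
have dD' : d%:R <= 3 * D%:R :> R by rewrite -natrM ler_nat.
have hh : 0 < 1 - h ^+ 2.
  by rewrite (_ : 1 - h ^+ 2 = (1 - h) * (1 + h)); [rewrite mulr_gt0//; lra|ring].
set u := _ / (_ * _).
have u0 : 0 <= u.
  by rewrite divr_ge0 ?mulr_ge0 ?sqr_ge0 ?ler0n// ltW.
(* Since [d <= 3 * D], the product [n * u] is at most [12 * a / (m * (1 - h ^+ 2))]; the factor 96
   in the assumption on [m] brings this below [(1 + l) / 2]. *)
have nu : n%:R * u <= 1 / 2 + l / 2.
  have -> : n%:R * u = 4 * a * d%:R / (D%:R * m%:R * (1 - h ^+ 2)).
    by rewrite /u /a natrM; field; rewrite !lt0r_neq0.
  rewrite ler_pdivrMr ?mulr_gt0//.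
  have : 96 * a <= m%:R * ((1 - h) * (1 + l)) by rewrite -ler_pdivrMr.
  have h2 : (1 - h) * (1 + l) <= (1 - h ^+ 2) * (1 + l).
    by rewrite ler_wpM2r; nra.
  have : m%:R * ((1 - h) * (1 + l)) <= m%:R * ((1 - h ^+ 2) * (1 + l)).
    by rewrite ler_pM2l.
  move=> H1 H2; have {H1 H2} H : 96 * a <= m%:R * ((1 - h ^+ 2) * (1 + l)) by lra.
  have : D%:R * (96 * a) <= D%:R * (m%:R * ((1 - h ^+ 2) * (1 + l))).
    by rewrite ler_pM2l.
  have : a * d%:R <= a * (3 * D%:R) by rewrite ler_pM2l.
  have : 0 <= D%:R * a by rewrite mulr_ge0// ltW.
  by nra.
(* Obtained by inverting [1 - 1 / 2 <= expR (- (1 / 2))]. *)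
have e2 : expR (1 / 2) <= 2 :> R.
  have := expR_ge1Dx (- (1 / 2) : R); rewrite expRN.
  have e0 := expR_gt0 (1 / 2 : R).
  by rewrite -[X in _ <= X -> _]mul1r ler_pdivlMr//; lra.
have : (1 + u) ^+ n <= 2 * E.
  apply: (@le_trans _ _ (expR (n%:R * u))).
    by rewrite expRM_natl lerXn2r ?nnegrE ?expR_ge0 ?expR_ge1Dx//; lra.
  apply: (@le_trans _ _ (expR (1 / 2 + l / 2))); first by rewrite ler_expR.
  by rewrite expRD ler_wpM2r// expR_ge0.
have : 0 <= E by exact: expR_ge0.
lra.
Qed.

Theorem mainTheorem6 (R : realType) :
  exists2 kappa : R, 0 < kappa &
    forall (d n : nat) (h : R),
      (2 <= d)%N -> (1 <= n)%N -> 0 <= h <= 1 ->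
      Num.sqrt (d%:R / n%:R) <= h ->
      ((kappa * (1 - h) * (d%:R / (n%:R * h)) *
        (1 + ln (n%:R * h ^+ 2 / d%:R)))%:E
       <= minimax_risk n h (@halfspace_classifiers R d))%E.
Proof.
(* Here [194 = 2 * 97]: the 2 comes from the bound [h / (2 * m)], and [97 / 96] is the price of
   rounding [y >= 96] up to an integer [m]. *)
exists 194^-1; first by rewrite invr_gt0.
move=> d n h d2 n1 /andP[h0 h1] dnh.
have n0 : 0 < n%:R :> R by rewrite ltr0n.
have d0 : 0 < d%:R :> R by rewrite ltr0n; lia.
have D0 : (0 < d./2)%N by lia.
have dD : (2 * d./2 <= d)%N by lia.
have dd : (0 < d <= 3 * d./2)%N by lia.
have hgt0 : 0 < h by apply: lt_le_trans dnh; rewrite sqrtr_gt0 divr_gt0.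
(* At [h = 1] the block length would divide by zero, but the claimed bound vanishes. Nonnegativity
   of the minimax risk suffices, and follows with [m = 1] and [r = 0]. *)
have [hlt1|hge1] := ltP h 1; last first.
  have -> : h = 1 by lra.
  rewrite subrr mulr0 !mul0r.
  have [x xP] := @needle_halfspace R d d./2 1 D0 dD.
  have := @needle_minimax_risk _ _ R _ 1 n _ x 1 0 D0 isT _ xP.
  rewrite mulr0; apply; first by rewrite ltr01 lexx.
  move=> g; exists [ffun=> ord0]; apply: sumr_ge0 => w _.
  rewrite mulr_ge0 ?sumr_ge0// prodr_ge0// => i _.
  by rewrite noisy_weight_ge0// ler01 lexx.
set a := n%:R * h ^+ 2 / d%:R.
(* This is the assumption [h >= sqrt (d / n)], squared. *)
have a1 : 1 <= a.
  rewrite /a ler_pdivlMr// mul1r mulrC -ler_pdivrMr// -[leLHS]sqr_sqrtr.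
    by rewrite lerXn2r ?nnegrE ?sqrtr_ge0.
  by rewrite divr_ge0 ?ltW.
have l0 : 0 <= ln a by rewrite ln_ge0.
have la : 1 + ln a <= a.
  by apply: le_trans (expR_ge1Dx _) _; rewrite lnK// posrE; lra.
pose y := 96 * a / ((1 - h) * (1 + ln a)).
have hl : 0 < (1 - h) * (1 + ln a) by rewrite mulr_gt0//; lra.
have y96 : 96 <= y.
  rewrite /y ler_pdivlMr// ler_pM2l//; apply: le_trans la.
  by rewrite ler_piMl; lra.
have [m [mgt0 my ym]] : exists m, [/\ (0 < m)%N, m%:R <= y + 1 & y <= m%:R].
  have y0 : 0 <= y by lra.
  exists (Num.truncn y).+1; have /andP[ty yt] := truncn_itv y0.
  by split; [|rewrite -natr1 lerD2r|exact: ltW].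
have [x xP] := @needle_halfspace R d d./2 m D0 dD.
have h01 : 0 < h <= 1 by rewrite hgt0.
apply: le_trans (@needle_minimax_risk _ _ R _ m n _ x h (d./2%:R / 2) D0 mgt0 h01 xP _).
  have D0' : 0 < d./2%:R :> R by rewrite ltr0n.
  have m0 : 0 < m%:R :> R by rewrite ltr0n.
  rewrite lee_fin natrM.
  have -> : h / (d./2%:R * m%:R) * (d./2%:R / 2) = h / (2 * m%:R).
    by field; rewrite !lt0r_neq0.
  have -> : d%:R / (n%:R * h) = h / a.
    by rewrite /a; field; rewrite !lt0r_neq0.
  have m97 : m%:R <= 97 / 96 * y by lra.
  rewrite ler_pdivlMr ?mulr_gt0//.
  apply: (@le_trans _ _ (194^-1 * (1 - h) * (h / a) * (1 + ln a) * (2 * (97 / 96 * y)))).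
    apply: ler_wpM2l; last by rewrite ler_pM2l.
    apply: mulr_ge0; last by lra.
    by rewrite mulr_ge0 ?divr_ge0// ?mulr_ge0 ?invr_ge0 ?subr_ge0//; lra.
  rewrite le_eqVlt; apply/orP; left; apply/eqP; rewrite /y; field.
  by rewrite !lt0r_neq0//; lra.
move=> g; apply: needle_lower_bound => //; first by rewrite hlt1 ltW.
exact: (needle_size (introT andP (conj hgt0 hlt1)) D0 dd a1 ym).
Qed.
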